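(* Let $\mathcal{M}$ be a matroid with matroid polytope $P_{\mathcal{M}}$, let $v\in\mathrm{Dr}_{\mathcal{M}}$ be a valuation on $\mathcal{M}$, let $L$ be the lineality space of the Dressian $\mathrm{Dr}_{\mathcal{M}}$, and let $\Delta_v$ be the matroid subdivision of $P_{\mathcal{M}}$ induced by $v$. Then $$\Delta_v=\{P_{\mathcal{M}_w} : w\in v+L\}.$$
   Context: Let $\mathcal{M}$ be a matroid of rank $d$ on $[n]$ with set of bases $\mathcal{B}$. The Dressian $\mathrm{Dr}_{\mathcal{M}}\subset\mathbb{R}^{\mathcal{B}}$ is the set of $v\in\mathbb{R}^{\mathcal{B}}$ such that, extending $v$ by $v_\sigma=\infty$ for $d$-subsets $\sigma\notin\mathcal{B}$, for every $S\in\binom{[n]}{d-2}$ and distinct $i,j,k,l\in[n]\setminus S$ the minimum of $v_{Sij}+v_{Skl}$, $v_{Sik}+v_{Sjl}$, $v_{Sil}+v_{Sjk}$ is attained at least twice (or is $\infty$), where $Sij=S\cup\{i,j\}$. The points of $\mathrm{Dr}_{\mathcal{M}}$ are the valuations on $\mathcal{M}$. The lineality space of $\mathrm{Dr}_{\mathcal{M}}$ is the largest linear subspace $L\subset\mathbb{R}^{\mathcal{B}}$ such that $w+u\in\mathrm{Dr}_{\mathcal{M}}$ for all $w\in\mathrm{Dr}_{\mathcal{M}}$, $u\in L$. For $w\in\mathrm{Dr}_{\mathcal{M}}$, the initial matroid $\mathcal{M}_w$ is the matroid with bases $\{\sigma\in\mathcal{B}: w_\sigma\text{ is minimal}\}$.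 The matroid polytope is $P_{\mathcal{M}}=\mathrm{conv}\{e_\sigma:\sigma\in\mathcal{B}\}$, $e_\sigma=\sum_{i\in\sigma}e_i\in\mathbb{R}^n$. $\Delta_v$ is the regular subdivision of $P_{\mathcal{M}}$ induced by $v$, regarded as the set of all its nonempty cells of all dimensions: the cells are the projections to $\mathbb{R}^n$ of the nonempty lower faces of $\mathrm{conv}\{(e_\sigma,v_\sigma):\sigma\in\mathcal{B}\}\subset\mathbb{R}^{n+1}$, i.e. the faces on which a linear functional with last coordinate positive is minimized. It is a known fact that $\Delta_v$ is a matroid subdivision (all cells are matroid polytopes) if and only if $v\in\mathrm{Dr}_{\mathcal{M}}$. *)

(* Defs.v *)
From mathcomp Require Import all_boot all_order all_algebra.
From mathcomp Require Import all_classical all_reals all_analysis.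
From mathcomp Require Import lra zify.

Set Implicit Arguments.
Unset Strict Implicit.
Unset Printing Implicit Defensive.

Import Order.TTheory GRing.Theory Num.Theory.

Local Open Scope classical_set_scope.
Local Open Scope ring_scope.

Record matroid (n d : nat) := Matroid {
  bases : {set {set 'I_n}};
  bases_neq0 : bases != finset.set0;
  card_base : {in bases, forall s : {set 'I_n}, #|s| = d};
  base_exchange : {in bases &, forall s t : {set 'I_n}, forall i,
    i \in s :\: t -> exists2 j, j \in t :\: s & j |: (s :\ i) \in bases} }.

Definition base n d (M : matroid n d) := {s : {set 'I_n} | s \in bases M}.

(* The space R^B.  The codomain is R^o, i.e. R as a module over itself, which
   makes R^B a vectType, so that {vspace baseFun R M} is available. *)
Definition baseFun (R : realType) n d (M : matroid n d) :=
  {ffun base M -> R^o}.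

Section Dressian.
Variables (R : realType) (n d : nat) (M : matroid n d).

Definition ext_val (v : baseFun R M) (s : {set 'I_n}) : \bar R :=
  if insub s is Some b then (v b)%:E else +oo%E.

Definition min_twice (a b c : \bar R) : Prop :=
  let m := Order.min a (Order.min b c) in
  m = +oo%E \/ (2 <= count (pred1 m) [:: a; b; c])%N.

Definition Dressian : set (baseFun R M) := [set v |
  forall S : {set 'I_n}, #|S|.+2 = d ->
  forall i j k l : 'I_n, uniq [:: i; j; k; l] ->
    all (fun x => x \notin S) [:: i; j; k; l] ->
    let V x y := ext_val v (x |: (y |: S)) in
    min_twice (V i j + V k l)%E (V i k + V j l)%E (V i l + V j k)%E].

Definition preserves_Dressian (L : {vspace baseFun R M}) : Prop :=
  forall w u, Dressian w -> u \in L -> Dressian (w + u).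

Definition is_lineality_space (L : {vspace baseFun R M}) : Prop :=
  preserves_Dressian L /\
  forall L' : {vspace baseFun R M}, preserves_Dressian L' -> (L' <= L)%VS.

Lemma lineality_space_exists : exists L, is_lineality_space L.
Proof.
pose P k := `[< exists2 L : {vspace baseFun R M},
                  preserves_Dressian L & \dim L = k >].
have exP : exists k, P k.
  exists 0%N; apply/asboolP; exists 0%VS; last exact: dimv0.
  by move=> w u Dw; rewrite memv0 => /eqP ->; rewrite addr0.
have leP k : P k -> (k <= \dim (@fullv R (baseFun R M)))%N.
  by move=> /asboolP[L _ <-]; apply: dimvS; apply: subvf.
case: (ex_maxnP exP leP) => k /asboolP[L pL dimL] maxk.
exists L; split=> // L' pL'.
have pLL' : preserves_Dressian (L + L')%VS.
  move=> w u Dw /memv_addP[a aL [b bL' ->]]; rewrite addrA.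
  by apply: pL' => //; apply: pL.
have := maxk (\dim (L + L')%VS); rewrite -dimL => max'.
have {}max' : (\dim (L + L')%VS <= \dim L)%N.
  by apply: max'; apply/asboolP; exists (L + L')%VS.
have /eqP -> : L == (L + L')%VS by rewrite eqEdim addvSl.
exact: addvSr.
Qed.

Definition initial_bases (w : baseFun R M) : {set {set 'I_n}} :=
  [set val s | s : base M & [forall t : base M, w s <= w t]].

(* The remainder of this section shows that initial_bases w is the set of bases
   of a matroid when w is a valuation: the three-term relations imply the
   exchange property of valuated matroids for all pairs of bases, by induction
   on the size of their difference. *)

Lemma base_coexchange (A C : {set 'I_n}) i :
  A \in bases M -> C \in bases M -> i \in A :\: C ->
  exists2 j, j \in C :\: A & i |: (C :\ j) \in bases M.
Proof.
move=> AB CB iAC.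
pose P X := [&& X \in bases M, i \in X, A :&: C \subset X
              & X \subset A :|: C].
have PA : P A.
  by rewrite /P AB finset.subsetIl finset.subsetUl !andbT /=; case/setDP: iAC.
case: (@arg_maxnP _ A P (fun X => #|X :&: C|) PA) => X /and4P[XB iX sX Xs] maxX.
have [iA iC] := setDP iAC.
have XC : X :\: C = [set i]%SET.
  apply/finset.setP => x; rewrite finset.in_set1; apply/idP/eqP; last first.
    by move=> ->; rewrite finset.in_setD iC iX.
  move=> xXC; apply/eqP; apply: contraT => xi.
  have [y yCX YB] := base_exchange XB CB xXC.
  have [yC yX] := setDP yCX; have [xX xC] := setDP xXC.
  have /maxX : P (y |: X :\ x).
    apply/and4P; split => //.
    - by rewrite !finset.inE iX [i == x]eq_sym xi orbT.
    - apply/fintype.subsetP=> z zI; rewrite !finset.inE (fintype.subsetP sX _ zI) andbT.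
      case: (eqVneq z x) zI => [->|_ _] /=; last by rewrite orbT.
      by rewrite !finset.inE (negbTE xC) andbF.
    - apply/fintype.subsetP=> z; rewrite !finset.inE => /orP[/eqP ->|/andP[_ zX]].
        by rewrite yC orbT.
      by move: (fintype.subsetP Xs _ zX); rewrite !finset.inE.
  have -> : (y |: X :\ x) :&: C = y |: (X :&: C).
    apply/finset.setP=> z; rewrite !finset.inE.
    case: (eqVneq z y) => [->|_] //=.
    by case: (eqVneq z x) => [->|_] //=; rewrite (negbTE xC) andbF.
  by rewrite cardsU1 !finset.inE (negbTE yX) /= ltnn.
have cX : #|C :\: X| = 1%N.
  have := cardsID C X; have := cardsID X C; rewrite XC cards1.
  by rewrite (card_base XB) (card_base CB) finset.setIC; lia.
have /cards1P[j jE] : #|C :\: X| == 1%N by rewrite cX.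
have /setDP[jC jX] : j \in C :\: X by rewrite jE finset.in_set1.
exists j.
  rewrite finset.in_setD jC andbT; apply: contra jX => jA.
  by apply: (fintype.subsetP sX); rewrite finset.in_setI jA.
suff -> : i |: C :\ j = X by [].
apply/finset.setP=> z.
move/finset.setP/(_ z): XC; move/finset.setP/(_ z): jE; rewrite !finset.inE.
by case: (z \in X); case: (z \in C); case: (z == i); case: (z == j).
Qed.

Definition real_val (w : baseFun R M) (s : {set 'I_n}) : R :=
  oapp w 0 (insub s).

Lemma ext_valE w s :
  ext_val w s = if s \in bases M then (real_val w s)%:E else +oo%E.
Proof. by rewrite /ext_val /real_val; case: insubP => [b -> _|/negbTE ->]. Qed.

Lemma min_twice_strict (a : R) (b c : \bar R) :
  (a%:E < b)%E -> (a%:E < c)%E -> ~ min_twice a%:E b c.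
Proof.
move=> ab ac; rewrite /min_twice.
have -> : Order.min a%:E (Order.min b c) = a%:E.
  by apply/min_idPl; rewrite le_min !ltW.
by case=> //=; rewrite eqxx (gt_eqF ab) (gt_eqF ac).
Qed.

Lemma Dressian_local w (S : {set 'I_n}) (i j k l : 'I_n) :
  Dressian w ->
  uniq [:: i; j; k; l] -> all (fun x => x \notin S) [:: i; j; k; l] ->
  i |: (j |: S) \in bases M -> k |: (l |: S) \in bases M ->
  let f x y := real_val w (x |: (y |: S)) in
  let B x y := x |: (y |: S) \in bases M in
  [/\ B i k, B j l & f i k + f j l <= f i j + f k l] \/
  [/\ B i l, B j k & f i l + f j k <= f i j + f k l].
Proof.
move=> Dw uq nS Bij Bkl f B.
have cS : #|S|.+2 = d.
  rewrite -(card_base Bij) !cardsU1 !finset.inE.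
  move: uq nS => /=; rewrite !finset.inE !negb_or.
  by case/andP => /and3P[/negbTE -> _ _] _ /and5P[/negbTE -> /negbTE -> _ _ _].
have := Dw S cS i j k l uq nS; rewrite /= !ext_valE Bij Bkl.
rewrite -!/(f _ _) -!/(B _ _) -EFinD => H.
have E x y z t : ((if B x y then (f x y)%:E else +oo) +
          (if B z t then (f z t)%:E else +oo) <= (f i j + f k l)%:E)%E ->
        [/\ B x y, B z t & f x y + f z t <= f i j + f k l].
  by case: (B x y); case: (B z t).
have [/E|ltb] := leP ((if B i k then (f i k)%:E else +oo) +
  (if B j l then (f j l)%:E else +oo))%E (f i j + f k l)%:E; first by left.
have [/E|ltc] := leP ((if B i l then (f i l)%:E else +oo) +
  (if B j k then (f j k)%:E else +oo))%E (f i j + f k l)%:E; first by right.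
by case: (min_twice_strict ltb ltc).
Qed.

Lemma Dressian_exchange w A C u : Dressian w ->
  A \in bases M -> C \in bases M -> u \in A :\: C ->
  exists v, [/\ v \in C :\: A, v |: (A :\ u) \in bases M,
    u |: (C :\ v) \in bases M &
    real_val w (v |: (A :\ u)) + real_val w (u |: (C :\ v)) <=
      real_val w A + real_val w C].
Proof.
move=> Dw; set f := real_val w.
have [m] := ubnP #|C :\: A|; elim: m => // m IHm in A C u * => cm AB CB uAC.
have [uA uC] := setDP uAC.
have [//|nex] := pselect (exists v, [/\ v \in C :\: A,
  v |: (A :\ u) \in bases M, u |: (C :\ v) \in bases M &
  f (v |: (A :\ u)) + f (u |: (C :\ v)) <= f A + f C]).
have neg v : v \in C :\: A -> v |: (A :\ u) \in bases M ->
    u |: (C :\ v) \in bases M ->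
    f A + f C < f (v |: (A :\ u)) + f (u |: (C :\ v)).
  move=> v1 v2 v3; rewrite ltNge; apply/negP => v4.
  by apply: nex; exists v.
pose p v := if v |: (A :\ u) \in bases M then f A - f (v |: (A :\ u))
            else f (u |: (C :\ v)) - f C - 1.
have plt v : v \in C :\: A -> u |: (C :\ v) \in bases M ->
    p v < f (u |: (C :\ v)) - f C.
  move=> v1 v3; rewrite /p; case: ifP => v2; last by lra.
  by have := neg _ v1 v2 v3; lra.
have [u0 u0AC u0u] : exists2 u0, u0 \in A :\: C & u0 != u.
  apply: contrapT => nu0.
  have AC : A :\: C = [set u]%SET.
    apply/finset.setP=> x; rewrite finset.in_set1; apply/idP/eqP => [xAC|->//].
    by apply/eqP; apply: contraT => xu; case: nu0; exists x.
  have cC : #|C :\: A| = 1%N.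
    have := cardsID C A; have := cardsID A C; rewrite AC cards1.
    by rewrite (card_base AB) (card_base CB) finset.setIC; lia.
  have /cards1P[v vE] : #|C :\: A| == 1%N by rewrite cC.
  have E1 : v |: (A :\ u) = C.
    apply/finset.setP=> z.
    move/finset.setP/(_ z): AC; move/finset.setP/(_ z): vE; rewrite !finset.inE.
    by case: (z \in A); case: (z \in C); case: (z == u); case: (z == v).
  have E2 : u |: (C :\ v) = A.
    apply/finset.setP=> z.
    move/finset.setP/(_ z): AC; move/finset.setP/(_ z): vE; rewrite !finset.inE.
    by case: (z \in A); case: (z \in C); case: (z == u); case: (z == v).
  apply: nex; exists v; rewrite E1 E2; split => //.
    by rewrite vE finset.in_set1.
  by rewrite addrC.
have [u0A u0C] := setDP u0AC.
have [v1 v1CA Bv1] := base_coexchange AB CB u0AC.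
pose P v := (v \in C :\: A) && (u0 |: (C :\ v) \in bases M).
have Pv1 : P v1 by rewrite /P v1CA.
case: (@Order.TotalTheory.arg_minP _ R _ v1 P
   (fun v => f (u0 |: (C :\ v)) - p v) Pv1)
  => v0 /andP[v0CA Bv0] minv0.
have [v0C v0A] := setDP v0CA.
pose C' := u0 |: (C :\ v0).
have uC' : u \in A :\: C'.
  by rewrite !finset.inE uA (negbTE uC) eq_sym (negbTE u0u) /= andbF.
have C'A : C' :\: A = (C :\: A) :\ v0.
  apply/finset.setP=> z; rewrite !finset.inE.
  by case: (eqVneq z u0) => [->|_] /=; rewrite ?u0A ?andbF //= andbCA.
have cm' : (#|C' :\: A| < m)%N.
  by move: cm; rewrite C'A (cardsD1 v0 (C :\: A)) v0CA add1n ltnS.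
have [v [vC'A Bv BX le1]] := IHm A C' u cm' AB Bv0 uC'.
move: vC'A; rewrite C'A finset.in_setD1 => /andP[vv0 vCA].
have [vC vA] := setDP vCA.
pose S := C :\ v0 :\ v.
have nab a b : a \in A -> b \notin A -> (a == b) = false.
  by move=> aA bA; apply/eqP => ab; rewrite -ab aA in bA.
have uq : uniq [:: v0; v; u0; u].
  rewrite /= !finset.inE !negb_or [v0 == v]eq_sym vv0 u0u.
  by rewrite ![_ == u0]eq_sym ![_ == u]eq_sym !nab.
have nS : all (fun x => x \notin S) [:: v0; v; u0; u].
  by rewrite /= !finset.inE !eqxx (negbTE uC) (negbTE u0C) !andbF.
have EC : v0 |: (v |: S) = C.
  apply/finset.setP=> z; rewrite !finset.inE.
  case: (eqVneq z v0) => [->|_] //=.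
  by case: (eqVneq z v) => [->|_].
have EX : u0 |: (u |: S) = u |: (C' :\ v).
  apply/finset.setP=> z; rewrite !finset.inE.
  case: (eqVneq z u0) => [->|_] /=; last by case: (z == u); case: (z == v).
  by rewrite (nab u0 v) // orbT.
have E1 : v0 |: (u0 |: S) = u0 |: (C :\ v).
  apply/finset.setP=> z; rewrite !finset.inE.
  case: (eqVneq z v0) => [->|_] /=; last by case: (z == u0).
  by rewrite v0C [v0 == v]eq_sym vv0 orbT.
have E2 : v |: (u |: S) = u |: (C :\ v0).
  apply/finset.setP=> z; rewrite !finset.inE.
  case: (eqVneq z v) => [->|_] /=; last by case: (z == u).
  by rewrite vC vv0 orbT.
have E3 : v0 |: (u |: S) = u |: (C :\ v).
  apply/finset.setP=> z; rewrite !finset.inE.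
  case: (eqVneq z v0) => [->|_] /=; last by case: (z == u).
  by rewrite v0C [v0 == v]eq_sym vv0 orbT.
have E4 : v |: (u0 |: S) = C'.
  apply/finset.setP=> z; rewrite !finset.inE.
  case: (eqVneq z v) => [->|_] /=; last by case: (z == u0).
  by rewrite vC vv0 orbT.
have := @Dressian_local w S v0 v u0 u Dw uq nS.
rewrite EC EX => /(_ CB BX) /=.
rewrite EC EX E1 E2 E3 E4 -!/(f _) => -[[B1 B2 le2]|[B1 B2 le2]].
  have := minv0 v; rewrite /P vCA B1 => /(_ isT) le3.
  have := plt _ v0CA B2.
  have : p v = f A - f (v |: (A :\ u)) by rewrite /p Bv.
  move: le1 le2 le3; rewrite -!/(f _) -/C'.
  move: (p v) (p v0) (f A) (f C) (f C') (f (v |: _)) (f (u |: (C' :\ v)))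
    (f (u |: (C :\ v0))) (f (u0 |: (C :\ v))).
  by clear; move=> *; lra.
have := neg _ vCA Bv B1.
move: le1 le2; rewrite -!/(f _).
move: (f A) (f C) (f C') (f (v |: _)) (f (u |: (C' :\ v))) (f (u |: (C :\ v))).
by clear; move=> *; lra.
Qed.

Lemma initial_basesP w s :
  reflect (s \in bases M /\
           {in bases M, forall t, real_val w s <= real_val w t})
          (s \in initial_bases w).
Proof.
apply: (iffP imsetP) => [[b]|[sB smin]].
  rewrite finset.inE => /forallP bmin ->; split; first exact: valP.
  by move=> t tB; rewrite /real_val valK insubT /=; apply: bmin.
exists (exist _ s sB) => //; rewrite finset.inE; apply/forallP => -[t tB].
by have := smin t tB; rewrite /real_val !insubT.
Qed.

Lemma initial_bases_neq0 w : initial_bases w != finset.set0.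
Proof.
have [s0 s0B] := set0Pn _ (bases_neq0 M).
case: (@Order.TotalTheory.arg_minP _ R _ s0 (mem (bases M)) (real_val w) s0B).
move=> s sB smin; apply/set0Pn; exists s; apply/initial_basesP.
by split.
Qed.

Lemma initial_bases_card w : {in initial_bases w, forall s : {set 'I_n}, #|s| = d}.
Proof. by move=> s /initial_basesP[sB _]; exact: card_base sB. Qed.

Lemma initial_bases_exchange w : Dressian w ->
  {in initial_bases w &, forall s t : {set 'I_n}, forall i,
    i \in s :\: t ->
    exists2 j, j \in t :\: s & j |: (s :\ i) \in initial_bases w}.
Proof.
move=> Dw s t /initial_basesP[sB smin] /initial_basesP[tB tmin] i ist.
have [j [jts B1 B2 le1]] := Dressian_exchange Dw sB tB ist.
exists j => //; apply/initial_basesP; split=> // r rB.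
by have := tmin _ B2; have := smin _ rB; lra.
Qed.

Definition initial_matroid (w : baseFun R M) (Dw : Dressian w) : matroid n d :=
  Matroid (initial_bases_neq0 w) (@initial_bases_card w)
          (initial_bases_exchange Dw).

End Dressian.

Definition conv_hull (R : realType) (E : lmodType R) (A : set E) : set E :=
  smallest (@convex_set R (convex_lmodType E)) A.

Definition indicator_row (R : realType) n (s : {set 'I_n}) : 'rV[R]_n :=
  \row_i (i \in s)%:R.

Definition matroid_polytope (R : realType) n d (M : matroid n d) :
  set 'rV[R]_n := conv_hull [set indicator_row R s | s in [set` bases M]].
Arguments matroid_polytope R {n d} M.

Definition lifted_polytope (R : realType) n d (M : matroid n d)
    (v : baseFun R M) : set 'rV[R]_(n + 1) :=
  conv_hull [set row_mx (indicator_row R (val s)) (v s)%:M | s in [set: base M]].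

Definition minimizing_face (R : realType) m (c : 'cV[R]_m) (Q : set 'rV[R]_m) :
  set 'rV[R]_m := [set x | Q x /\ forall y, Q y -> (x *m c) 0 0 <= (y *m c) 0 0].

Definition regular_subdivision (R : realType) n d (M : matroid n d)
    (v : baseFun R M) : set (set 'rV[R]_n) :=
  [set C | exists c : 'cV[R]_(n + 1),
    let F := minimizing_face c (lifted_polytope v) in
    [/\ 0 < c (rshift n ord0) 0, F !=set0 & C = lsubmx @` F]].

(* Main.v *)
(* A valuation u lies in the lineality space iff it is affine, i.e.
   u_s = k + sum_{i in s} c_i.  Affine functions shift the three terms of every
   Dressian relation equally.  Conversely, u and -u both lie in the Dressian, so
   all finite terms of each three-term relation coincide.  Affineness is then
   proved on the bases inside X, adding one element e to X at a time from a
   fixed base B0: the potential of e is forced by f(B0 - b + e), and these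
   values agree for all b in the same component of the fundamental graph of B0
   because a walk between two such b can be shortened by pivoting.  The exchange
   property of u and -u propagates vanishing from the neighbours of B0 to all
   bases.  Finally, minimizing the functional (c, t) on the lifted polytope is
   minimizing the valuation v + c/t on the bases. *)
Require Import Defs.
From mathcomp Require Import all_boot all_order all_algebra.
From mathcomp Require Import all_classical all_reals all_analysis.
From mathcomp Require Import ring lra.

Set Implicit Arguments.
Unset Strict Implicit.
Unset Printing Implicit Defensive.

Import Order.TTheory GRing.Theory Num.Theory.

Local Open Scope classical_set_scope.
Local Open Scope ring_scope.

(** * Convex hulls, their linear images and the faces on which a functional is minimal *)

Section ConvexHull.
Variable R : realType.

Lemma convex_setP (E : lmodType R) (A : set E) :
  @convex_set R (convex_lmodType E) A <->
  forall (x y : E) (l : {i01 R}), A x -> A y ->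
    A (l%:num *: x + (1 - l%:num) *: y).
Proof.
split=> cA x y l.
  by move=> Ax Ay; have := cA x y l; rewrite !inE; apply.
by rewrite !inE => Ax Ay; apply: cA.
Qed.

Lemma conv_hull_convex (E : lmodType R) (A : set E) (x y : E) (l : {i01 R}) :
  conv_hull A x -> conv_hull A y ->
  conv_hull A (l%:num *: x + (1 - l%:num) *: y).
Proof.
move=> Ax Ay B [/[dup] cB /convex_setP cB' AB].
by apply: cB'; [apply: Ax|apply: Ay].
Qed.

Lemma sub_conv_hull (E : lmodType R) (A : set E) : A `<=` conv_hull A.
Proof. exact: sub_gen_smallest. Qed.

Lemma conv_hull_sub (E : lmodType R) (A B : set E) :
  (forall (x y : E) (l : {i01 R}), B x -> B y ->
     B (l%:num *: x + (1 - l%:num) *: y)) ->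
  A `<=` B -> conv_hull A `<=` B.
Proof. by move=> /convex_setP cB AB; apply: smallest_sub. Qed.

Lemma image_conv_hull (E F : lmodType R) (g : {linear E -> F}) (A : set E) :
  g @` conv_hull A = conv_hull (g @` A).
Proof.
apply/seteqP; split.
  move=> _ [x Ax <-].
  have : conv_hull A `<=` g @^-1` conv_hull (g @` A).
    apply: conv_hull_sub => [y z l Ay Az|y Ay].
      by rewrite /preimage /= linearD !linearZ; apply: conv_hull_convex.
    by apply: sub_conv_hull; exists y.
  exact.
apply: conv_hull_sub => [_ _ l [y Ay <-] [z Az <-]|_ [y Ay <-]].
  exists (l%:num *: y + (1 - l%:num) *: z); first exact: conv_hull_convex.
  by rewrite linearD !linearZ.
by exists y => //; apply: sub_conv_hull.
Qed.

(** A convex combination of points of [A] reaches the minimum only if every point with positive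
    weight does. *)
Lemma minimizing_face_conv_hull m (c : 'cV[R]_m) (A : set 'rV[R]_m) a :
  A a -> (forall x, A x -> (a *m c) 0 0 <= (x *m c) 0 0) ->
  minimizing_face c (conv_hull A) =
  conv_hull [set x | A x /\ (x *m c) 0 0 = (a *m c) 0 0].
Proof.
move=> Aa amin; set mu := (a *m c) 0 0; set A0 := [set x | _].
have phiE (x y : 'rV[R]_m) (l : R) : ((l *: x + (1 - l) *: y) *m c) 0 0 =
    l * (x *m c) 0 0 + (1 - l) * (y *m c) 0 0.
  by rewrite mulmxDl -!scalemxAl !mxE.
have ge_mu : conv_hull A `<=` [set x | mu <= (x *m c) 0 0].
  apply: conv_hull_sub => // x y l /= mx my; rewrite phiE.
  have l0 : 0 <= l%:num by []. have l1 : l%:num <= 1 by [].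
  by nra.
have sub0 : conv_hull A0 `<=` conv_hull A.
  apply: conv_hull_sub; first by move=> *; apply: conv_hull_convex.
  by move=> x [Ax _]; apply: sub_conv_hull.
have eq0 : conv_hull A0 `<=` [set x | (x *m c) 0 0 = mu].
  apply: conv_hull_sub => [x y l /= mx my|x []//]; rewrite phiE mx my.
  by ring.
apply/seteqP; split => [x [Ax xmin]|x A0x]; last first.
  split=> [|y Ay]; first exact: sub0.
  by rewrite (eq0 _ A0x); apply: ge_mu.
(* This union is convex: with both weights positive, one point above [mu] already lifts the
   combination above [mu]. A minimizing [x] cannot lie in the first part. *)
have : conv_hull A `<=` [set y | mu < (y *m c) 0 0 \/ conv_hull A0 y].
  apply: conv_hull_sub => [y z l /= Hy Hz|y Ay /=]; last first.
    have := amin y Ay; rewrite le_eqVlt => /orP[/eqP e|]; last by left.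
    by right; apply: sub_conv_hull.
  have l0 : 0 <= l%:num by []. have l1 : l%:num <= 1 by [].
  have [e|n0] := eqVneq l%:num 0; first by rewrite e scale0r add0r subr0 scale1r.
  have [e|n1] := eqVneq l%:num 1.
    by rewrite e subrr scale0r addr0 scale1r.
  have {}l0 : 0 < l%:num by rewrite lt_neqAle eq_sym n0.
  have {}l1 : l%:num < 1 by rewrite lt_neqAle n1.
  rewrite phiE.
  have [[hy|hy] [hz|hz]] := (Hy, Hz).
  - by left; nra.
  - by left; rewrite (eq0 _ hz); nra.
  - by left; rewrite (eq0 _ hy); nra.
  - by right; apply: conv_hull_convex.
move=> /(_ x Ax) /= [|//].
by rewrite ltNge (xmin a (sub_conv_hull Aa)).
Qed.

End ConvexHull.

(** * Affine functions on the bases and their action on the Dressian *)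

Section AffineValuation.
Variables (R : realType) (n d : nat) (M : matroid n d).
Implicit Types (w u : baseFun R M) (A B S X : {set 'I_n}) (c : 'I_n -> R).

Definition aff c (k : R) : baseFun R M :=
  [ffun b : base M => k + \sum_(i in val b) c i].

Lemma real_valE w (b : base M) : real_val w (val b) = w b.
Proof. by rewrite /real_val valK. Qed.

Lemma real_valD w u A : real_val (w + u) A = real_val w A + real_val u A.
Proof.
by rewrite /real_val; case: insubP => [b _ _|_] /=; rewrite ?ffunE // addr0.
Qed.

Lemma real_valN w A : real_val (- w) A = - real_val w A.
Proof.
by rewrite /real_val; case: insubP => [b _ _|_] /=; rewrite ?ffunE // oppr0.
Qed.

Lemma real_val_aff c k A :
  A \in bases M -> real_val (aff c k) A = k + \sum_(i in A) c i.
Proof. by move=> AB; rewrite /real_val insubT /= ffunE. Qed.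

Lemma aff_scale (t : R) c k : t *: aff c k = aff (fun i => t * c i) (t * k).
Proof.
by apply/ffunP => b; rewrite !ffunE /GRing.scale /= mulrDr mulr_sumr.
Qed.

Lemma affN c k : - aff c k = aff (fun i => - c i) (- k).
Proof. by apply/ffunP => b; rewrite !ffunE opprD sumrN. Qed.

Lemma ext_val_aff w c k A :
  ext_val (w + aff c k) A = (ext_val w A + (k + \sum_(i in A) c i)%:E)%E.
Proof.
rewrite !ext_valE; case: ifPn => // AB.
by rewrite real_valD real_val_aff.
Qed.

Lemma min_twice_shift (a b e : \bar R) (p q r : R) : p = q -> q = r ->
  min_twice a b e -> min_twice (a + p%:E) (b + q%:E) (e + r%:E).
Proof.
move=> -> ->.
have minD (x y : \bar R) :
    Order.min (x + r%:E)%E (y + r%:E)%E = (Order.min x y + r%:E)%E.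
  by rewrite !minEle leeD2rE //; case: ifP.
have eqD (x y : \bar R) : ((x + r%:E)%E == (y + r%:E)%E) = (x == y).
  by rewrite !eq_le !leeD2rE.
rewrite /min_twice !minD /= !eqD; case; last by right.
by move=> ->; left.
Qed.

(** Each of the three terms covers [S] twice and [i], [j], [l], [m] once, so all three are shifted
    by the same constant. *)
Lemma Dressian_aff w c k : Dressian w -> Dressian (w + aff c k).
Proof.
move=> Dw S cS i j l m uq nS /=; rewrite !ext_val_aff.
have /= := Dw S cS i j l m uq nS.
have sumE x y : x \notin S -> y \notin S -> x != y ->
    \sum_(z in x |: (y |: S)) c z = c x + c y + \sum_(z in S) c z.
  by move=> xS yS xy; rewrite !finset.big_setU1 ?finset.in_setU1 ?negb_or ?xy //= addrA.
move: uq nS; rewrite /= !seq.inE !negb_or !andbT.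
case/and3P=> /and3P[ij il im] /andP[jl jm] lm /and4P[iS jS lS mS].
have addE (a b : \bar R) (p q : R) :
    (a + p%:E + (b + q%:E) = a + b + (p + q)%:E)%E.
  by rewrite addeACA EFinD.
rewrite !sumE // !addE => H.
by apply: min_twice_shift H; ring.
Qed.

(** * The three-term exchange property of bases and the zero valuation *)

Lemma min_twice_bool (p q r : bool) : (p -> q || r) -> (q -> p || r) ->
  (r -> p || q) ->
  min_twice (if p then 0%E else +oo%E : \bar R) (if q then 0%E else +oo%E)
            (if r then 0%E else +oo%E).
Proof.
rewrite /min_twice; case: p; case: q; case: r => // p1 p2 p3;
  rewrite ?minxx ?miney ?minye ?minxx /= ?eqxx //; by [left|right|
  have := p1 isT|have := p2 isT|have := p3 isT].
Qed.

Lemma uniq4E (T : eqType) (x y z t : T) : uniq [:: x; y; z; t] =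
  [&& x != y, x != z, x != t, y != z, y != t & z != t].
Proof. by rewrite /= !seq.inE !negb_or !andbT -!andbA. Qed.

Lemma pair_exchange S x y z t :
  uniq [:: x; y; z; t] -> all (fun s => s \notin S) [:: x; y; z; t] ->
  x |: (y |: S) \in bases M -> z |: (t |: S) \in bases M ->
  ((z |: (y |: S) \in bases M) || (t |: (y |: S) \in bases M)) &&
  ((x |: (z |: S) \in bases M) || (x |: (t |: S) \in bases M)).
Proof.
rewrite uniq4E /= !andbT => /and5P[xy xz xt yz /andP[yt zt]] /and4P[xS yS zS tS].
move=> Bxy Bzt.
have xD : x \in (x |: (y |: S)) :\: (z |: (t |: S)).
  by rewrite !finset.inE !negb_or xz xt xS eqxx.
have jD j : j \in (z |: (t |: S)) :\: (x |: (y |: S)) -> (j == z) || (j == t).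
  rewrite !finset.inE !negb_or => /andP[/and3P[_ _ /negbTE ->]].
  by rewrite orbF.
have E1 : (x |: (y |: S)) :\ x = y |: S.
  by rewrite finset.setU1K // !finset.inE negb_or xy.
have E2 : (z |: (t |: S)) :\ z = t |: S.
  by rewrite finset.setU1K // !finset.inE negb_or zt.
have E3 : (z |: (t |: S)) :\ t = z |: S.
  by rewrite finset.setUCA finset.setU1K // !finset.inE negb_or eq_sym zt.
apply/andP; split.
  have [j /jD /orP[]/eqP ->] := base_exchange Bxy Bzt xD;
    by rewrite E1 => ->; rewrite ?orbT.
have [j /jD /orP[]/eqP ->] := base_coexchange Bxy Bzt xD;
  by rewrite ?E2 ?E3 => ->; rewrite ?orbT.
Qed.

(** [pair_exchange] in both directions shows that if one set of the first pairing is not a basis,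
    then both sets of the other pairing are. *)
Lemma three_term_exchange S x y z t :
  uniq [:: x; y; z; t] -> all (fun s => s \notin S) [:: x; y; z; t] ->
  x |: (y |: S) \in bases M -> z |: (t |: S) \in bases M ->
  (x |: (z |: S) \in bases M) && (y |: (t |: S) \in bases M) ||
  (x |: (t |: S) \in bases M) && (y |: (z |: S) \in bases M).
Proof.
move=> uq nS Bxy Bzt; have := pair_exchange uq nS Bxy Bzt.
have uq' : uniq [:: z; t; x; y].
  by rewrite -(perm_uniq (permEl (perm_catC [:: x; y] [:: z; t]))).
have nS' : all (fun s => s \notin S) [:: z; t; x; y].
  by move: nS => /= /and5P[-> -> -> -> _].
have := pair_exchange uq' nS' Bzt Bxy.
rewrite (finset.setUCA [set z]) (finset.setUCA [set z] [set y]).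
rewrite (finset.setUCA [set t] [set y]).
case: (x |: (t |: S) \in bases M); case: (x |: (z |: S) \in bases M);
  case: (y |: (t |: S) \in bases M); case: (y |: (z |: S) \in bases M) => /=; by [].
Qed.

(** With all finite terms equal to 0, a relation fails only if exactly one term is finite, which
    [three_term_exchange] excludes. *)
Lemma Dressian0 : Dressian (0 : baseFun R M).
Proof.
move=> S cS i j l m uq nS /=.
pose B x y := x |: (y |: S) \in bases M.
have val0 x y : ext_val (0 : baseFun R M) (x |: (y |: S)) =
    if B x y then 0%E else +oo%E.
  by rewrite /ext_val /B; case: insubP => [b -> _|/negbTE ->]; rewrite ?ffunE.
have add0 (p q : bool) : ((if p then 0 else +oo) + (if q then 0 else +oo) =
    if p && q then 0 else +oo :> \bar R)%E.
  by case: p; case: q; rewrite ?adde0.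
rewrite !val0 !add0.
have BC x y : B x y = B y x by rewrite /B finset.setUCA.
have := uq; have := nS; rewrite uniq4E /= andbT.
case/and4P => iS jS lS mS /and5P[ij il im jl /andP[jm lm]].
apply: min_twice_bool => /andP[B1 B2].
- by have := three_term_exchange uq nS B1 B2.
- have := @three_term_exchange S i l j m; rewrite -!/(B _ _) (BC l j).
  apply=> //; last by rewrite /= iS lS jS mS.
  by rewrite uniq4E il ij im eq_sym jl lm jm.
- have := @three_term_exchange S i m j l; rewrite -!/(B _ _) (BC m l) (BC m j).
  apply=> //; last by rewrite /= iS mS jS lS.
  by rewrite uniq4E im ij il ![m == _]eq_sym jm lm jl.
Qed.

(** * Swaps of one element of a basis and the relations forced by [u] and [- u] together *)

Definition swap B b x := x |: (B :\ b).

Lemma swap_setU1 S b x : b \notin S -> swap (b |: S) b x = x |: S.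
Proof. by move=> bS; rewrite /swap finset.setU1K. Qed.

Lemma in_swap B b x y : (y \in swap B b x) = (y == x) || (y != b) && (y \in B).
Proof. by rewrite !finset.inE. Qed.

Lemma local_eq u S i j k l : Dressian u -> Dressian (- u) ->
  uniq [:: i; j; k; l] -> all (fun x => x \notin S) [:: i; j; k; l] ->
  let B x y := x |: (y |: S) \in bases M in
  let f x y := real_val u (x |: (y |: S)) in
  B i j -> B k l -> B i k -> B j l -> f i j + f k l = f i k + f j l.
Proof.
move=> Du Dnu uq nS B f Bij Bkl Bik Bjl.
have fC x y : f x y = f y x by rewrite /f finset.setUCA.
have BC x y : B x y = B y x by rewrite /B finset.setUCA.
have := uq; have := nS; rewrite uniq4E /= andbT.
case/and4P => iS jS kS lS /and5P[ij ik il jk /andP[jl kl]].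
(* [p] and [q] are the two sums to compare, [r] is the third. If they differed, the relations for
   [u] would put [r] at or below the smaller one, those for [- u] at or above the larger one. *)
have key (p q r : R) : q <= p \/ r <= p -> p <= q \/ r <= q ->
    p <= q \/ p <= r -> q <= p \/ q <= r -> p = q.
  case: (ltgtP p q) => // pq; last first.
    move=> _ [//|rq] [//|pr] _.
    by move: (lt_le_trans pq (le_trans pr rq)); rewrite ltxx.
  move=> [//|rp] _ _ [//|qr].
  by move: (lt_le_trans pq (le_trans qr rp)); rewrite ltxx.
have uq2 : uniq [:: i; k; j; l].
  by rewrite uniq4E ik ij il eq_sym jk kl jl.
have nS2 : all (fun x => x \notin S) [:: i; k; j; l].
  by rewrite /= iS jS kS lS.
have := Dressian_local Du uq nS Bij Bkl.
have := Dressian_local Du uq2 nS2 Bik Bjl.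
have := Dressian_local Dnu uq nS Bij Bkl.
have := Dressian_local Dnu uq2 nS2 Bik Bjl.
rewrite /= !real_valN -!/(f _ _) -!/(B _ _) (BC k j) (fC k j).
move=> H4 H3 H2 H1; apply: (@key _ _ (f i l + f j k)).
- by case: H1 => [[_ _ ?]|[_ _ ?]]; [left|right]; lra.
- by case: H2 => [[_ _ ?]|[_ _ ?]]; [left|right]; lra.
- by case: H3 => [[_ _ ?]|[_ _ ?]]; [left|right]; lra.
- by case: H4 => [[_ _ ?]|[_ _ ?]]; [left|right]; lra.
Qed.

Lemma four_points B b1 b2 x1 x2 : b1 \in B -> b2 \in B -> b1 != b2 ->
  x1 \notin B -> x2 \notin B -> x1 != x2 ->
  exists S, [/\ B = b1 |: (b2 |: S), uniq [:: b2; x1; b1; x2]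
             & all (fun y => y \notin S) [:: b2; x1; b1; x2]].
Proof.
move=> b1B b2B b12 x1B x2B x12; exists (B :\ b1 :\ b2).
have nab a b : a \in B -> b \notin B -> a != b.
  by move=> aB bB; apply: contraNneq bB => <-.
split.
- by rewrite !finset.setD1K // !finset.inE eq_sym b12.
- by rewrite uniq4E [b2 == b1]eq_sym [x1 == b1]eq_sym b12 x12 !nab.
- by rewrite /= !finset.inE !eqxx (negbTE x1B) (negbTE x2B) !andbF.
Qed.

Lemma swapE S b1 b2 x1 x2 : uniq [:: b2; x1; b1; x2] ->
  all (fun y => y \notin S) [:: b2; x1; b1; x2] ->
  let B := b1 |: (b2 |: S) in
  [/\ swap B b1 x1 = b2 |: (x1 |: S), swap B b2 x2 = b1 |: (x2 |: S),
      swap B b1 x2 = b2 |: (x2 |: S), swap B b2 x1 = x1 |: (b1 |: S)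
    & swap (swap B b1 x1) b2 x2 = x1 |: (x2 |: S)].
Proof.
rewrite uniq4E /= andbT => /and5P[b2x1 b21 b2x2 x1b1 /andP[x1x2 b1x2]].
move=> /and4P[b2S x1S b1S x2S].
have E1 x : swap (b1 |: (b2 |: S)) b1 x = b2 |: (x |: S).
  by rewrite swap_setU1 1?finset.setUCA // !finset.inE eq_sym (negbTE b21).
have E2 x : swap (b1 |: (b2 |: S)) b2 x = b1 |: (x |: S).
  by rewrite finset.setUCA swap_setU1 1?finset.setUCA // !finset.inE (negbTE b21).
rewrite !E1 !E2; split=> //; first exact: finset.setUCA.
by rewrite swap_setU1 1?finset.setUCA // !finset.inE (negbTE b2x1).
Qed.

(** * Valuations with a valuation as negative, along the fundamental graph of a basis *)

Section Modular.
Variable u : baseFun R M.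
Hypotheses (Du : Dressian u) (Dnu : Dressian (- u)).
Local Notation f := (real_val u).

(** Both sides are finite terms of the relation at [B] minus [b1] and [b2], so [local_eq] equates
    them. *)
Lemma swap_square B b1 b2 x1 x2 : b1 \in B -> b2 \in B -> b1 != b2 ->
  x1 \notin B -> x2 \notin B -> x1 != x2 ->
  swap B b1 x1 \in bases M -> swap B b2 x2 \in bases M ->
  swap B b1 x2 \in bases M -> swap B b2 x1 \in bases M ->
  f (swap B b1 x1) + f (swap B b2 x2) = f (swap B b1 x2) + f (swap B b2 x1).
Proof.
move=> b1B b2B b12 x1B x2B x12.
have [S [-> uq nS]] := four_points b1B b2B b12 x1B x2B x12.
have [-> -> -> -> _] := swapE uq nS.
have uq' : uniq [:: b2; x1; x2; b1].
  have /perm_uniq <- // : perm_eq ([:: b2; x1] ++ [:: b1; x2]) [:: b2; x1; x2; b1].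
  by rewrite (perm_cat2l _ _ [:: x2; b1]) (permEl (perm_catC [:: b1] [:: x2])).
have nS' : all (fun y => y \notin S) [:: b2; x1; x2; b1].
  by move: nS => /= /and5P[-> -> -> -> _].
rewrite (finset.setUCA [set b1] [set x2]) => B1 B2 B3 B4.
exact: (local_eq Du Dnu uq' nS').
Qed.
(** Exchange between the two swaps yields either the crossed pair of swaps or the pair of [B] and
    the double swap. The crossed pair is excluded, and [local_eq] equates the two remaining
    terms. *)
Lemma swap_pivot B b1 b2 x1 x2 : b1 \in B -> b2 \in B -> b1 != b2 ->
  x1 \notin B -> x2 \notin B -> x1 != x2 -> B \in bases M ->
  swap B b1 x1 \in bases M -> swap B b2 x2 \in bases M ->
  ~~ ((swap B b1 x2 \in bases M) && (swap B b2 x1 \in bases M)) ->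
  swap (swap B b1 x1) b2 x2 \in bases M /\
  f B + f (swap (swap B b1 x1) b2 x2) = f (swap B b1 x1) + f (swap B b2 x2).
Proof.
move=> b1B b2B b12 x1B x2B x12.
have [S [-> uq nS]] := four_points b1B b2B b12 x1B x2B x12.
have [-> -> -> -> ->] := swapE uq nS => B0 B1 B2 nB.
rewrite (finset.setUCA [set b1] [set b2]) in B0 *.
have := three_term_exchange uq nS B1 B2; rewrite (negbTE nB) orbF => /andP[_ B12].
by split=> //; rewrite (local_eq Du Dnu uq nS).
Qed.

(** The bipartite fundamental graph of [B], restricted to [X]. *)
Definition edge X B b x :=
  [&& b \in B, x \in X, x \notin B & swap B b x \in bases M].

(* A walk b, x1, b1, x2, b2, ... in the fundamental graph of B is encoded by the
   list of the pairs (xi, bi). *)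
Lemma walk_constant X e : e \notin X ->
  (forall A, A \in bases M -> A \subset X -> f A = 0) ->
  forall (s : seq ('I_n * 'I_n)) B b x, B \in bases M -> B \subset X ->
  path (fun p q => edge X B p.2 q.1 && edge X B q.2 q.1) (x, b) s ->
  let b' := (last (x, b) s).2 in
  b \in B -> swap B b e \in bases M -> swap B b' e \in bases M ->
  f (swap B b e) = f (swap B b' e).
Proof.
move=> eX f0 s; have [m] := ubnP (size s); elim: m => // m IHm in s *.
case: s => [|[x1 b2] s] //= + B b x BB BX /andP[/andP[e1 e2] ps] bB Be.
rewrite ltnS => sm.
have [bB' x1X x1B B1] := and4P e1; have [b2B _ _ B2] := and4P e2.
have eB : e \notin B by apply: contra eX => /(fintype.subsetP BX).
have x1e : x1 != e by apply: contraNneq eX => <-.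
have swapX a y : y \in X -> swap B a y \subset X.
  move=> yX; apply/fintype.subsetP => z; rewrite in_swap => /orP[/eqP ->//|].
  by move=> /andP[_ /(fintype.subsetP BX)].
have [eb|bb2] := eqVneq b b2; first by subst b2; apply: (IHm s) ps _ _.
(* If [b2] is adjacent to [e], then [b], [x1], [b2], [e] form a 4-cycle, and [f] vanishes on the two
   swaps that bring in [x1], as they lie in [X]. *)
case B2e : (swap B b2 e \in bases M) => Be'.
  have -> : f (swap B b e) = f (swap B b2 e).
    have := swap_square bB b2B bb2 x1B eB x1e B1 B2e Be B2.
    by rewrite (f0 _ B1 (swapX _ _ x1X)) (f0 _ B2 (swapX _ _ x1X)) add0r addr0.
  exact: (IHm s) ps _ _ _.
(* A later [a] adjacent to [x1] gives a shortcut past the part of the walk before it. *)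
have [/hasP[[y a] ycs /= ec]|/hasPn nadj] :=
    boolP (has (fun q => edge X B q.2 x1) s).
  case/splitPr: ycs sm ps Be' => s1 s2 sm.
  rewrite cat_path last_cat /= => /and3P[_ _ ps] Be'.
  have lastE : (last (y, a) s2).2 = (last (x1, a) s2).2 by case: (s2).
  rewrite lastE in Be' *; apply: (IHm ((x1, a) :: s2) _ B b x) => //=.
    by apply: leq_trans sm; rewrite size_cat /= addnS !ltnS leq_addl.
  by rewrite e1 ec; case: s2 ps {sm Be' lastE}.
case: s sm ps Be' nadj => [|[x2 b3] s] sm /=; first by rewrite B2e.
move=> /andP[/andP[e22 e32] ps] Be' nadj.
have [_ x2X x2B B22] := and4P e22.
have [bx2|nbx2] := boolP (edge X B b x2).
  by apply: (IHm ((x2, b3) :: s) _ B b x) => //=; rewrite bx2 e32.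
have x12 : x1 != x2 by apply: contraNneq nbx2 => <-.
have nBx2 : swap B b x2 \notin bases M.
  by move: nbx2; rewrite /edge bB x2X x2B.
(* Pivoting on (b2, x1) drops these two vertices from the walk: the edge from b
   to x2 appears, and all later edges survive since x1 has no later neighbour. *)
pose B' := swap B b2 x1.
(* Since [b2] is not adjacent to [e], [swap_pivot] applies; [f] vanishes on [B] and [B'], so the
   value is kept. *)
have B'e a : a \in B -> swap B a e \in bases M ->
    swap B' a e \in bases M /\ f (swap B' a e) = f (swap B a e).
  move=> cB Bc.
  have b2c : b2 != a by apply: contraFneq B2e => ->.
  have [|Bc' fc] := swap_pivot b2B cB b2c x1B eB x1e BB B2 Bc.
    by rewrite B2e.
  split=> //; move: fc.
  by rewrite (f0 _ BB BX) (f0 _ B2 (swapX _ _ x1X)) !add0r.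
have edge' a y : edge X B a y -> ~~ edge X B a x1 -> edge X B' a y.
  move=> /and4P[cB yX yB Bcy] ncx1.
  have b2c : b2 != a by apply: contraNneq ncx1 => <-.
  have x1y : x1 != y.
    by apply: contraNneq ncx1 => ->; rewrite /edge cB yX yB.
  have [|Bcy' _] := swap_pivot b2B cB b2c x1B yB x1y BB B2 Bcy.
    by move: ncx1; rewrite /edge cB x1X x1B /= => /negbTE ->; rewrite andbF.
  by rewrite /edge !in_swap yX Bcy' cB [a == b2]eq_sym b2c (negbTE yB) !andbF
             [y == x1]eq_sym (negbTE x1y) orbT.
(* The swap of [b] for [x2] is not a basis, so the pivot is done with [(b2, x2)] and [(b, x1)]; the
   resulting double swap is the same set. *)
have ebx2 : edge X B' b x2.
  have b2b : b2 != b by rewrite eq_sym.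
  have x21 : x2 != x1 by rewrite eq_sym.
  have [|Bx2 _] := swap_pivot b2B bB b2b x2B x1B x21 BB B22 B1.
    by rewrite negb_and nBx2 orbT.
  rewrite /edge !in_swap x2X bB bb2 orbT (negbTE x2B) andbF orbF eq_sym x12 /=.
  rewrite (_ : swap _ _ _ = swap (swap B b2 x2) b x1) //.
  apply/finset.setP => z; rewrite !in_swap.
  case: (eqVneq z x1) => [->|_] /=.
    have -> : x1 != b by apply: contraNneq x1B => ->.
    by rewrite orbT.
  case: (eqVneq z x2) => [->|_] //=.
  by have -> : x2 != b by apply: contraNneq x2B => ->.
set b' := (last _ _).2 in Be' *.
have b'B : b' \in B.
  rewrite /b'; case/lastP: s ps {sm nadj Be' b'} => [_|s q] /=.
    by case/and4P: e32.
  by rewrite rcons_path last_rcons => /and3P[_ _ /and4P[]].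
have [Bb Eb] := B'e b bB Be; have [Bb' Eb'] := B'e b' b'B Be'.
rewrite -Eb -Eb'.
apply: (IHm ((x2, b3) :: s) _ B' b x) => //=; last 1 first.
- by rewrite in_swap bb2 bB orbT.
- exact: swapX.
rewrite ebx2 (edge' _ _ e32) /=; last exact: (nadj (x2, b3) (mem_head _ _)).
have all3 : all (fun q => ~~ edge X B q.2 x1) ((x2, b3) :: s).
  exact/allP.
apply: sub_in_path all3 ps => p q; rewrite !unfold_in => np nq /andP[ep eq].
by rewrite !edge'.
Qed.

(** Exchange turns [A] into a basis closer to [B0] and [B0] into a neighbour, and [f] vanishes on
    both. For [u] this gives [0 <= f A], for [- u] the opposite inequality. *)
Lemma eq0_of_neighbours X B0 : B0 \in bases M -> B0 \subset X -> f B0 = 0 ->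
  (forall b x, edge X B0 b x -> f (swap B0 b x) = 0) ->
  forall A, A \in bases M -> A \subset X -> f A = 0.
Proof.
move=> B0B B0X f0 fN A.
have [m] := ubnP #|A :\: B0|; elim: m => // m IHm in A * => cA AB AX.
have [AB0|/fintype.subsetPn[x xA xB0]] := boolP (A \subset B0).
  have /eqP -> // : A == B0.
  by rewrite eqEcard AB0 (card_base AB) (card_base B0B) leqnn.
have xD : x \in A :\: B0 by rewrite finset.in_setD xB0.
have step b : b \in B0 :\: A -> b |: (A :\ x) \in bases M ->
    x |: (B0 :\ b) \in bases M ->
    f (b |: (A :\ x)) = 0 /\ f (x |: (B0 :\ b)) = 0.
  rewrite finset.in_setD => /andP[bA bB0] B1 B2; split; last first.
    by apply: fN; rewrite /edge bB0 (fintype.subsetP AX) // xB0.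
  apply: IHm => //; last first.
    apply/fintype.subsetP => z; rewrite !finset.inE => /orP[/eqP ->|/andP[_]].
      exact: (fintype.subsetP B0X).
    exact: (fintype.subsetP AX).
  rewrite (_ : _ :\: _ = (A :\: B0) :\ x).
    by move: cA; rewrite (cardsD1 x (A :\: B0)) xD add1n ltnS.
  apply/finset.setP => z; rewrite !finset.inE.
  by case: (eqVneq z b) => [->|_] /=; rewrite ?bB0 ?andbF // andbCA.
have [b [b1 b2 b3]] := Dressian_exchange Du AB B0B xD.
have [-> ->] := step b b1 b2 b3; rewrite f0 addr0 => le1.
have [b' [b1' b2' b3']] := Dressian_exchange Dnu AB B0B xD.
rewrite !real_valN; have [-> ->] := step b' b1' b2' b3'; rewrite f0 => le2.
by apply/eqP; rewrite eq_le; apply/andP; split; lra.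
Qed.

End Modular.

(** * Construction of the affine function, one element at a time *)

Lemma sum_swap B b x c : b \in B -> x \notin B ->
  \sum_(i in swap B b x) c i = \sum_(i in B) c i + c x - c b.
Proof.
move=> bB xB; rewrite finset.big_setU1 ?finset.in_setD1 ?(negbTE xB) ?andbF //=.
by rewrite (finset.big_setD1 b bB) /=; ring.
Qed.

(** With the potential of [e] set to 0, a neighbour [b] of [e] needs the potential
    [- real_val u (swap B0 b e)]. Potentials constant on components make every swap inside [X]
    contribute 0. *)
Lemma affine_on_step u X B0 e : Dressian u -> Dressian (- u) ->
  B0 \in bases M -> B0 \subset X -> e \notin X ->
  (forall A, A \in bases M -> A \subset X -> real_val u A = 0) ->
  exists c k, forall A, A \in bases M -> A \subset e |: X ->
    real_val u A = real_val (aff c k) A.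
Proof.
move=> Du Dnu B0B B0X eX u0.
have eB0 : e \notin B0 by apply: contra eX => /(fintype.subsetP B0X).
(* [r] links elements of [B0] with a common neighbour, so its components on [B0] are those of the
   fundamental graph. *)
pose r b b' := [exists x, edge X B0 b x && edge X B0 b' x].
have r_sym : symmetric r.
  by move=> b b'; rewrite /r; apply: eq_existsb => x; rewrite andbC.
have walkP b b' : b \in B0 -> connect r b b' ->
    swap B0 b e \in bases M -> swap B0 b' e \in bases M ->
    real_val u (swap B0 b e) = real_val u (swap B0 b' e).
  move=> bB0 /connectP[p rp ->].
  suff [s ps ->] : exists2 s : seq ('I_n * 'I_n),
      path (fun p q => edge X B0 p.2 q.1 && edge X B0 q.2 q.1) (b, b) s &
      last b p = (last (b, b) s).2.
    by move=> B1 B2; apply: (walk_constant Du Dnu eX u0 B0B B0X ps).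
  (* The first entry of the starting pair is never read by the path relation; it is generalized so
     that the induction can restart at [(x, b1)]. *)
  have : b = (b, b).2 by []. move: (b, b) => t tE.
  elim: p b t tE {bB0} rp => [|b1 p IHp] b t tE /=; first by exists [::].
  move=> /andP[/existsP[x /andP[e1 e2]] rp].
  have [s ps sE] := IHp b1 (x, b1) erefl rp.
  by exists ((x, b1) :: s) => //=; rewrite -tE e1 e2.
pose adj b := (b \in B0) && (swap B0 b e \in bases M).
(* The value is read at any neighbour of [e] in the component of [y]; [walkP] makes the choice
   immaterial. Components without such a neighbour get 0. *)
pose h y := if [pick b | adj b & connect r y b] is Some b
            then - real_val u (swap B0 b e) else 0.
(* An element of [X] outside [B0] inherits the potential of a neighbour in [B0]. *)
pose nb x := odflt x [pick b | edge X B0 b x].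
have hE b : adj b -> h b = - real_val u (swap B0 b e).
  move=> /[dup] ab /andP[bB0 Bb]; rewrite /h.
  case: pickP => [b' /andP[/andP[_ Bb'] cb]|/(_ b)].
    by rewrite (walkP b b').
  by rewrite ab connect0.
have h_connect y z : connect r y z -> h y = h z.
  move=> cyz; rewrite /h; congr (if _ is Some b then _ else _).
  by apply: eq_pick => b /=; rewrite (same_connect (sym_connect_sym r_sym) cyz).
pose c y := if y == e then 0 else if y \in B0 then h y else h (nb y).
have cB b : b \in B0 -> c b = h b.
  by move=> bB0; rewrite /c bB0; case: eqP => // be; rewrite be (negbTE eB0) in bB0.
have cX b x : edge X B0 b x -> c x = c b.
  move=> ebx; have [bB0 xX xB0 _] := and4P ebx.
  rewrite (cB b bB0) /c (negbTE xB0); case: eqP => [xe|_].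
    by rewrite -xe xX in eX.
  rewrite /nb; case: pickP => [b' eb'|/(_ b)]; last by rewrite ebx.
  by apply: h_connect; apply/connect1/existsP; exists x; rewrite eb'.
(* This constant makes [aff c k] vanish at [B0], as [u] does; only the neighbours of [B0] remain to
   be compared. *)
pose k := - \sum_(i in B0) c i.
have Dv : Dressian (u - aff c k) by rewrite affN; apply: Dressian_aff.
have Dnv : Dressian (- (u - aff c k)) by rewrite opprB addrC; apply: Dressian_aff.
exists c, k => A AB AX; apply/eqP; rewrite -subr_eq0 -real_valN -real_valD; apply/eqP.
have sE w A' : A' \in bases M -> real_val (w - aff c k) A' =
    real_val w A' - (k + \sum_(i in A') c i).
  by move=> A'B; rewrite real_valD real_valN real_val_aff.
apply: (eq0_of_neighbours Dv Dnv B0B _ _ _ AB AX).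
- exact: fintype.subset_trans B0X (finset.subsetUr _ _).
- by rewrite sE // u0 // /k; ring.
move=> b x /and4P[bB0 + xB0 Bbx]; rewrite finset.in_setU1 sE // sum_swap //.
move=> /orP[/eqP xe|xX]; last first.
  rewrite (cX b x) ?/edge ?bB0 ?xX ?xB0 // u0 //; first by rewrite /k; ring.
  apply/fintype.subsetP => z; rewrite in_swap => /orP[/eqP -> //|/andP[_]].
  exact: (fintype.subsetP B0X).
rewrite xe in Bbx *; rewrite (cB b) // hE ?/adj ?bB0 //.
by rewrite /c eqxx /k; ring.
Qed.

(** The only basis inside [B0] is [B0], where a constant suffices. For a further element [e],
    subtracting the affine function found on [X :\ e] gives a valuation vanishing there, the input
    of [affine_on_step]. *)
Lemma affine_of_opp u : Dressian u -> Dressian (- u) ->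
  exists c k, u = aff c k.
Proof.
move=> Du Dnu; have [B0 B0B] := set0Pn _ (bases_neq0 M).
suff H X : B0 \subset X -> exists c k, forall A, A \in bases M ->
    A \subset X -> real_val u A = real_val (aff c k) A.
  have [c [k E]] := H [set: 'I_n]%SET (finset.subsetT _).
  exists c, k; apply/ffunP => b.
  by rewrite -!real_valE E ?(valP b) // finset.subsetT.
have [m] := ubnP #|X :\: B0|; elim: m => // m IHm in X * => cX B0X.
have [XB0|/fintype.subsetPn[e eX eB0]] := boolP (X \subset B0).
  exists (fun=> 0), (real_val u B0) => A AB AX.
  rewrite real_val_aff // big1 // addr0.
  have /eqP -> // : A == B0.
  by rewrite eqEcard (card_base AB) (card_base B0B) leqnn (fintype.subset_trans AX).
have [||c [k E]] := IHm (X :\ e).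
- have eD : e \in X :\: B0 by rewrite finset.in_setD eB0.
  rewrite finset.setDDl finset.setUC -finset.setDDl.
  by move: cX; rewrite (cardsD1 e) eD add1n ltnS.
- by rewrite finset.subsetD1 B0X.
have Dv : Dressian (u - aff c k) by rewrite affN; apply: Dressian_aff.
have Dnv : Dressian (- (u - aff c k)) by rewrite opprB addrC; apply: Dressian_aff.
have [|||c' [k' E']] := @affine_on_step _ (X :\ e) B0 e Dv Dnv B0B.
- by rewrite finset.subsetD1 B0X.
- by rewrite !finset.inE eqxx.
- by move=> A AB AX; rewrite real_valD real_valN E // subrr.
exists (fun i => c' i + c i), (k' + k) => A AB AX.
have := E' A AB; rewrite finset.setD1K // => /(_ AX).
rewrite real_valD real_valN !real_val_aff // big_split /=.
by move=> /eqP; rewrite subr_eq => /eqP ->; ring.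
Qed.

End AffineValuation.

(** * The lineality space as the space of affine functions *)

Section Lineality.
Variables (R : realType) (n d : nat) (M : matroid n d).
Variable L : {vspace baseFun R M}.
Hypothesis HL : is_lineality_space L.

(** Adding [u] and [- u] to the zero valuation puts both in the Dressian, so [affine_of_opp]
    applies. Conversely, the line spanned by an affine function preserves the Dressian, so
    maximality puts it in [L]. *)
Lemma lineality_affP u : u \in L <-> exists c k, u = aff M c k.
Proof.
have [pL maxL] := HL; split=> [uL|[c [k ->]]].
  apply: affine_of_opp; first by rewrite -(add0r u); apply: pL uL; exact: Dressian0.
  by rewrite -(add0r (- u)); apply: pL; [exact: Dressian0|rewrite memvN].
apply: (subvP (maxL <[aff M c k]>%VS _)); last exact: memv_line.
by move=> w _ Dw /vlineP[t ->]; rewrite aff_scale; apply: Dressian_aff.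
Qed.

End Lineality.

(** * Faces of the lifted polytope and initial matroids *)

Section Subdivision.
Variables (R : realType) (n d : nat) (M : matroid n d).

Definition functional (c : 'I_n -> R) (t : R) : 'cV[R]_(n + 1) :=
  col_mx (\col_i c i) t%:M.

Lemma functional_surj (a : 'cV[R]_(n + 1)) :
  a = functional (fun i => a (lshift 1 i) 0) (a (rshift n ord0) 0).
Proof.
rewrite /functional -[LHS]vsubmxK; congr col_mx.
  by apply/colP => i; rewrite !mxE.
by apply/colP => i; rewrite !mxE ord1 eqxx mulr1n.
Qed.

Lemma functionalE c t (s : {set 'I_n}) (x : R) :
  (row_mx (indicator_row R s) x%:M *m functional c t) 0 0 =
  \sum_(i in s) c i + x * t.
Proof.
rewrite /functional mul_row_col !mxE big_ord1 !mxE eqxx !mulr1n; congr (_ + _).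
rewrite [RHS]big_mkcond; apply: eq_bigr => i _; rewrite !mxE.
by case: (i \in s); rewrite ?mul1r ?mul0r.
Qed.

(** The functional takes the value [t * w s] at the lifted vertex of [s], so the minimizing vertices
    are the initial bases of [w]; projection commutes with convex hulls. *)
Lemma lifted_face (v : baseFun R M) c t (Dw : Dressian (v + aff M (fun i => t^-1 * c i) 0)) :
  0 < t ->
  let F := minimizing_face (functional c t) (lifted_polytope v) in
  F !=set0 /\ lsubmx @` F = matroid_polytope R (initial_matroid Dw).
Proof.
set w := v + _ in Dw * => t0 F.
have phiE (s : base M) :
    (row_mx (indicator_row R (val s)) (v s)%:M *m functional c t) 0 0 = t * w s.
  rewrite functionalE !ffunE add0r -mulr_sumr mulrDr mulrA mulfV ?gt_eqF //.
  by rewrite mul1r addrC mulrC.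
have [s0B0 /initial_basesP[s0B s0min]] := set0Pn _ (initial_bases_neq0 w).
pose s0 : base M := exist _ s0B0 s0B.
have {}s0min (s : base M) : w s0 <= w s.
  by rewrite -!real_valE; apply: s0min; exact: valP.
pose a := row_mx (indicator_row R (val s0)) (v s0)%:M.
have Fa : F = conv_hull [set row_mx (indicator_row R (val s)) (v s)%:M |
    s in [set s : base M | w s = w s0]].
  rewrite /F /lifted_polytope (@minimizing_face_conv_hull _ _ _ _ a).
  - congr conv_hull; apply/seteqP; split => [_ [[s _ <-] /=]|_ [s /= ws <-]].
      rewrite !phiE => /(mulfI (lt0r_neq0 t0)) ws.
      by exists s.
    by split; [exists s|rewrite !phiE ws].
  - by exists s0.
  - by move=> _ [s _ <-]; rewrite !phiE ler_pM2l.
split.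
  by exists a; rewrite Fa; apply: sub_conv_hull; exists s0.
rewrite Fa image_conv_hull; congr conv_hull.
apply/seteqP; split => [_ [_ [s /= ws <-] <-]|_ [s /= /initial_basesP[sB smin] <-]].
  exists (val s); last by rewrite row_mxKl.
  apply/initial_basesP; split; first exact: valP.
  move=> r rB; rewrite real_valE ws.
  have -> : real_val w r = w (exist _ r rB) := real_valE w (exist _ r rB).
  exact: s0min.
pose s' : base M := exist _ s sB.
exists (row_mx (indicator_row R s) (v s')%:M); last by rewrite row_mxKl.
exists s' => //=; apply/eqP; rewrite eq_le s0min andbT.
by have := smin _ s0B; rewrite -[s]/(val s') -[s0B0]/(val s0) !real_valE.
Qed.

End Subdivision.

Theorem proposition2p5 (R : realType) (n d : nat) (M : matroid n d)
    (v : baseFun R M) (Dv : Dressian v)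
    (L : {vspace baseFun R M}) (HL : is_lineality_space L) :
  regular_subdivision v =
  [set C | exists (w : baseFun R M) (Dw : Dressian w),
     [set v + u | u in [set` L]] w /\
     C = matroid_polytope R (initial_matroid Dw)].
Proof.
apply/seteqP; split => [C [a [a0 _ ->]]|C [w [Dw [[u uL uw] ->]]]] /=.
  rewrite (functional_surj a); set t := a (rshift n ord0) 0 in a0 *.
  pose c i := a (lshift 1 i) 0.
  have Dw : Dressian (v + aff M (fun i => t^-1 * c i) 0) by exact: Dressian_aff.
  exists _, Dw; split; last by case: (lifted_face Dw a0).
  by exists (aff M (fun i => t^-1 * c i) 0) => //; apply/(lineality_affP HL);
     exists (fun i => t^-1 * c i), 0.
move/(lineality_affP HL): uL => [c [k uE]]; subst u; subst w.
(* The functional gets last coordinate 1; the factor [1^-1] only matches the form of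
   [lifted_face]. *)
pose c1 := fun i => 1^-1 * c i.
have Dw1 : Dressian (v + aff M c1 0) by exact: Dressian_aff.
have [F0 FE] := lifted_face Dw1 ltr01.
exists (functional c 1); split => //; first by rewrite col_mxEd mxE eqxx ltr01.
rewrite FE; congr conv_hull.
(* The polytope depends only on the set of bases, and the constant [k] shifts all values alike. *)
suff E : initial_bases (v + aff M c k) = initial_bases (v + aff M c1 0).
  by rewrite /= E.
have -> : c1 = c by apply/funext => i; rewrite /c1 invr1 mul1r.
apply/finset.setP => s; apply/initial_basesP/initial_basesP => -[sB smin];
  split=> // t tB; have := smin t tB; rewrite !real_valD !real_val_aff //;
  by rewrite add0r; lra.
Qed.
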